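(* Consider the 1D special relativistic hydrodynamics (RHD) system with a Synge-type equation of state $h=h(\theta)=1+e(\theta)+\theta$, $\theta=p/\rho$, satisfying $e'(\theta)>0$ and $h(\theta)>\theta(1+e'(\theta))/e'(\theta)$ for all $\theta>0$. Set $z_1=\rho$, $z_2=\rho/p$, $z_3=\gamma v_1$. Then $$\widetilde{\mathbf F}^{EC}_1(\mathbf U_L,\mathbf U_R)=\left(\{\!\{z_1\}\!\}_{\ln}\{\!\{z_3\}\!\},\ \ \widehat{\rho h}\,\{\!\{z_3\}\!\}^2+\frac{\{\!\{z_1\}\!\}}{\{\!\{z_2\}\!\}},\ \ \widehat{\rho h}\,\{\!\{\gamma\}\!\}\{\!\{z_3\}\!\}\right)^\top$$ with $$\widehat{\rho h}:=\frac{\dfrac{\{\!\{z_1\}\!\}}{\{\!\{z_2\}\!\}}+\{\!\{z_1\}\!\}_{\ln}\,\mathcal E}{\{\!\{\gamma\}\!\}^2-\{\!\{z_3\}\!\}^2},\qquad \mathcal E:=\frac{[\![W_1]\!]-[\![\ln z_1]\!]}{[\![z_2]\!]},$$ is an entropy conservative (EC) two-point numerical flux for this system. Moreover, $\mathcal E$ can be reformulated as $$\mathcal E=1+\int_0^1 e\!\left(\frac{1}{z_{2,L}+s\,(z_{2,R}-z_{2,L})}\right)ds,$$ where $z_{2,L}$, $z_{2,R}$ are the values of $z_2$ at the left and right states.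
   Context: The 1D RHD system is $\partial_t\mathbf U+\partial_{x_1}\mathbf F_1(\mathbf U)=\mathbf 0$ with $\mathbf U=(D,m_1,E)^\top$, $\mathbf F_1=(Dv_1,\ v_1m_1+p,\ m_1)^\top$, $D=\rho\gamma$, $m_1=\rho h\gamma^2v_1$, $E=\rho h\gamma^2-p$, where $\rho>0$, $p>0$, $|v_1|<1$, $\gamma=(1-v_1^2)^{-1/2}$, $\theta=p/\rho$; $e$ is continuously differentiable on $(0,\infty)$. Let $S=-\ln\rho+\int^\theta\frac{e'(x)}{x}dx$ (a fixed antiderivative of $e'(\theta)/\theta$). The entropy variables (gradient with respect to $\mathbf U$ of the convex entropy $\eta=-DS$) are $\mathbf W=(W_1,W_2,W_3)^\top=\frac1\theta(h-\theta S,\ \gamma v_1,\ -\gamma)^\top$, and the entropy potential flux is $\psi_1=\rho\gamma v_1$. For states $\mathbf U_L,\mathbf U_R$, subscripts $L,R$ denote quantities evaluated at these states, and $[\![a]\!]=a_R-a_L$, $\{\!\{a\}\!\}=\frac12(a_L+a_R)$, and $\{\!\{a\}\!\}_{\ln}=[\![a]\!]/[\![\ln a]\!]$ is the logarithmic mean of positive quantities (equal to $a_L$ if $a_L=a_R$). If $[\![z_2]\!]=0$, $\mathcal E$ is understood as the limiting value, i.e. by its integral formula. A two-point numerical flux $\widetilde{\mathbf F}_1(\mathbf U_L,\mathbf U_R)$ is EC if it is consistent, $\widetilde{\mathbf F}_1(\mathbf U,\mathbf U)=\mathbf F_1(\mathbf U)$, and satisfies $(\mathbf W_R-\mathbf W_L)^\top\widetilde{\mathbf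 F}_1(\mathbf U_L,\mathbf U_R)=\psi_{1,R}-\psi_{1,L}$ for all $\mathbf U_L,\mathbf U_R$. *)

(* Defs.v *)
From Stdlib Require Import Reals Lra ClassicalEpsilon.
From Coquelicot Require Import Coquelicot.
Open Scope R_scope.

Definition vec3 : Type := (R * R * R)%type.

Definition dot3 (a b : vec3) : R :=
  let '(a1, a2, a3) := a in let '(b1, b2, b3) := b in
  a1 * b1 + a2 * b2 + a3 * b3.

Definition sub3 (a b : vec3) : vec3 :=
  let '(a1, a2, a3) := a in let '(b1, b2, b3) := b in
  (a1 - b1, a2 - b2, a3 - b3).

Definition enthalpy (e : R -> R) (th : R) : R := 1 + e th + th.

Definition synge_eos (e : R -> R) : Prop :=
  (forall th, 0 < th -> ex_derive e th) /\
  (forall th, 0 < th -> continuous (Derive e) th) /\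
  (forall th, 0 < th -> 0 < Derive e th) /\
  (forall th, 0 < th ->
     enthalpy e th > th * (1 + Derive e th) / Derive e th).

(* [sigma] is the antiderivative of [e'(th)/th] entering the entropy [S]. *)
Definition entropy_antiderivative (e sigma : R -> R) : Prop :=
  forall th, 0 < th -> is_derive sigma th (Derive e th / th).

(** ** Primitive variables *)

Record prim : Type := Prim { rho : R; vel : R; pre : R }.

Definition physical (w : prim) : Prop :=
  0 < rho w /\ 0 < pre w /\ Rabs (vel w) < 1.

Definition gam (w : prim) : R := / sqrt (1 - vel w ^ 2).
Definition theta (w : prim) : R := pre w / rho w.
Definition hh (e : R -> R) (w : prim) : R := enthalpy e (theta w).

Definition cons_of (e : R -> R) (w : prim) : vec3 :=
  (rho w * gam w,
   rho w * hh e w * gam w ^ 2 * vel w,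
   rho w * hh e w * gam w ^ 2 - pre w).

(** ** Quantities attached to a conservative state [U = (D, m1, E)] *)

Definition state (e : R -> R) (U : vec3) : Prop :=
  exists w, physical w /\ cons_of e w = U.

(* [U |-> (rho, v1, p)] has no closed form, so it is obtained by choice;
   [prim_of_cons_of] shows that it does invert [cons_of]. *)
Definition prim_of (e : R -> R) (U : vec3) : prim :=
  epsilon (inhabits (Prim 0 0 0)) (fun w => physical w /\ cons_of e w = U).

Definition flux1 (e : R -> R) (U : vec3) : vec3 :=
  let w := prim_of e U in
  let '(D, m1, E) := U in
  (D * vel w, vel w * m1 + pre w, m1).

Definition entropyS (e sigma : R -> R) (U : vec3) : R :=
  let w := prim_of e U in - ln (rho w) + sigma (theta w).

Definition W1 (e sigma : R -> R) (U : vec3) : R :=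
  let w := prim_of e U in
  / theta w * (hh e w - theta w * entropyS e sigma U).
Definition W2 (e : R -> R) (U : vec3) : R :=
  let w := prim_of e U in / theta w * (gam w * vel w).
Definition W3 (e : R -> R) (U : vec3) : R :=
  let w := prim_of e U in / theta w * (- gam w).

Definition entropy_vars (e sigma : R -> R) (U : vec3) : vec3 :=
  (W1 e sigma U, W2 e U, W3 e U).

Definition psi1 (e : R -> R) (U : vec3) : R :=
  let w := prim_of e U in rho w * gam w * vel w.

Definition gamU (e : R -> R) (U : vec3) : R := gam (prim_of e U).
Definition z1 (e : R -> R) (U : vec3) : R := rho (prim_of e U).
Definition z2 (e : R -> R) (U : vec3) : R :=
  let w := prim_of e U in rho w / pre w.
Definition z3 (e : R -> R) (U : vec3) : R :=
  let w := prim_of e U in gam w * vel w.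

(** ** Two-point fluxes *)

Definition jump (a : vec3 -> R) (UL UR : vec3) : R := a UR - a UL.
Definition mean (a : vec3 -> R) (UL UR : vec3) : R := (a UL + a UR) / 2.
Definition logmean (a : vec3 -> R) (UL UR : vec3) : R :=
  if Req_EM_T (a UL) (a UR) then a UL
  else jump a UL UR / jump (fun U => ln (a U)) UL UR.

Definition calE_integrand (e : R -> R) (UL UR : vec3) (s : R) : R :=
  e (1 / (z2 e UL + s * (z2 e UR - z2 e UL))).

(* When [z2] does not jump the quotient is 0/0 and is replaced by its limiting
   value, given by the integral formula. *)
Definition calE (e sigma : R -> R) (UL UR : vec3) : R :=
  if Req_EM_T (jump (z2 e) UL UR) 0
  then 1 + RInt (calE_integrand e UL UR) 0 1
  else (jump (W1 e sigma) UL UR - jump (fun U => ln (z1 e U)) UL UR)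
       / jump (z2 e) UL UR.

Definition rho_h_hat (e sigma : R -> R) (UL UR : vec3) : R :=
  (mean (z1 e) UL UR / mean (z2 e) UL UR
   + logmean (z1 e) UL UR * calE e sigma UL UR)
  / (mean (gamU e) UL UR ^ 2 - mean (z3 e) UL UR ^ 2).

Definition flux1_EC (e sigma : R -> R) (UL UR : vec3) : vec3 :=
  (logmean (z1 e) UL UR * mean (z3 e) UL UR,
   rho_h_hat e sigma UL UR * mean (z3 e) UL UR ^ 2
     + mean (z1 e) UL UR / mean (z2 e) UL UR,
   rho_h_hat e sigma UL UR * mean (gamU e) UL UR * mean (z3 e) UL UR).

Definition entropy_conservative (e sigma : R -> R)
    (F : vec3 -> vec3 -> vec3) : Prop :=
  (forall U, state e U -> F U U = flux1 e U) /\
  (forall UL UR, state e UL -> state e UR ->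
     dot3 (sub3 (entropy_vars e sigma UR) (entropy_vars e sigma UL)) (F UL UR)
     = psi1 e UR - psi1 e UL).

(** ** The primitive variables are determined by the conservative ones *)

(* Writing [q = E + p], one has [q^2 = m1^2 + D^2 h^2] and [p = th D^2 h / q];
   hence [E] is the following function of [th], for given [D] and [m1]. *)
Definition energy_of_theta (e : R -> R) (D m th : R) : R :=
  let q := sqrt (m ^ 2 + (D * enthalpy e th) ^ 2) in
  q - th * D ^ 2 * enthalpy e th / q.

Lemma enthalpy_pos (e : R -> R) (th : R) :
  synge_eos e -> 0 < th -> 0 < enthalpy e th.
Proof.
intros (_ & _ & H1 & H2) Hth.
specialize (H1 th Hth); specialize (H2 th Hth).
apply Rlt_trans with (2 := H2).
apply Rdiv_lt_0_compat; [apply Rmult_lt_0_compat|]; lra.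
Qed.

Lemma energy_of_theta_lt (e : R -> R) (D m a b : R) :
  synge_eos e -> 0 < D -> 0 < a -> a < b ->
  energy_of_theta e D m a < energy_of_theta e D m b.
Proof.
intros He HD Ha Hab.
pose (q th := sqrt (m ^ 2 + (D * enthalpy e th) ^ 2)).
pose (df th := D ^ 2 / q th *
  (enthalpy e th * Derive e th - th * (1 + Derive e th)
   + th * (1 + Derive e th) * ((D * enthalpy e th) ^ 2 / q th ^ 2))).
assert (Hq : forall th, 0 < th -> 0 < m ^ 2 + (D * enthalpy e th) ^ 2).
{ intros th Hth.
  assert (0 <= m ^ 2) by apply pow2_ge_0.
  assert (0 < (D * enthalpy e th) ^ 2); [|lra].
  apply pow_lt, Rmult_lt_0_compat; [lra|now apply enthalpy_pos]. }
apply (incr_function (energy_of_theta e D m) (Finite 0) p_infty df);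
  simpl; auto.
- intros th Hth _. unfold energy_of_theta, df.
  pose proof (Hq th Hth) as Hq'.
  assert (Hs : 0 < q th) by (apply sqrt_lt_R0; exact Hq').
  assert (Hh : is_derive (enthalpy e) th (Derive e th + 1)).
  { unfold enthalpy. pose proof (proj1 He th Hth). auto_derive; [auto|].
    change (Derive (fun x => e x) th) with (Derive e th). ring. }
  unfold q in *. generalize dependent (enthalpy e). intros h q df Hq Hq' Hs Hh. cbv zeta.
  assert (Hs1 : sqrt (m * (m * 1) + D * h th * (D * h th * 1)) <> 0)
    by (apply Rgt_not_eq; exact Hs).
  auto_derive.
  + repeat split; auto; eexists; exact Hh.
  + change (Derive (fun x => h x) th) with (Derive h th).
    rewrite (is_derive_unique _ _ _ Hh).
    simpl. field. exact Hs1.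
- intros th Hth _. unfold df.
  assert (Hs : 0 < q th) by (apply sqrt_lt_R0, Hq, Hth).
  assert (Hd : 0 < Derive e th) by (apply He; exact Hth).
  assert (Hh : enthalpy e th > th * (1 + Derive e th) / Derive e th)
    by (apply He; exact Hth).
  apply Rmult_lt_0_compat.
  { apply Rdiv_lt_0_compat; [apply pow_lt|]; lra. }
  assert (th * (1 + Derive e th) < enthalpy e th * Derive e th).
  { apply (Rmult_lt_compat_r (Derive e th)) in Hh; [|exact Hd].
    replace (th * (1 + Derive e th) / Derive e th * Derive e th)
      with (th * (1 + Derive e th)) in Hh by (field; lra). exact Hh. }
  assert (0 <= th * (1 + Derive e th) * ((D * enthalpy e th) ^ 2 / q th ^ 2)).
  { apply Rmult_le_pos; [apply Rmult_le_pos; lra|].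
    apply Rdiv_le_0_compat; [apply pow2_ge_0|apply pow_lt; lra]. }
  lra.
Qed.

Lemma gam_pos (w : prim) : physical w -> 0 < gam w.
Proof.
intros (_ & _ & Hv). apply Rinv_0_lt_compat, sqrt_lt_R0.
apply Rabs_def2 in Hv. nra.
Qed.

Lemma gam_sqr (w : prim) : physical w -> gam w ^ 2 * (1 - vel w ^ 2) = 1.
Proof.
intros (_ & _ & Hv). apply Rabs_def2 in Hv.
assert (Hp : 0 < 1 - vel w ^ 2) by nra.
unfold gam. rewrite pow_inv, pow2_sqrt by lra. field. lra.
Qed.

Lemma energy_q (e : R -> R) (w : prim) :
  synge_eos e -> physical w ->
  sqrt ((rho w * hh e w * gam w ^ 2 * vel w) ^ 2
        + (rho w * gam w * hh e w) ^ 2) = rho w * hh e w * gam w ^ 2.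
Proof.
intros He Hw. pose proof (gam_pos w Hw). pose proof (gam_sqr w Hw) as Hg.
assert (0 < hh e w).
{ apply enthalpy_pos; [exact He|]. apply Rdiv_lt_0_compat; apply Hw. }
assert (0 < rho w) by apply Hw.
transitivity (sqrt ((rho w * hh e w * gam w ^ 2) ^ 2)).
- f_equal.
  replace ((rho w * gam w * hh e w) ^ 2)
    with ((rho w * hh e w * gam w) ^ 2 * (gam w ^ 2 * (1 - vel w ^ 2)))
    by (rewrite Hg; ring). ring.
- apply sqrt_pow2. repeat apply Rmult_le_pos; lra.
Qed.

Lemma cons_of_inj (e : R -> R) (w w' : prim) :
  synge_eos e -> physical w -> physical w' ->
  cons_of e w = cons_of e w' -> w = w'.
Proof.
intros He Hw Hw' Heq. unfold cons_of in Heq.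
pose proof (f_equal (fun c => fst (fst c)) Heq) as HD.
pose proof (f_equal (fun c => snd (fst c)) Heq) as Hm.
pose proof (f_equal snd Heq) as HE.
cbn [fst snd] in HD, Hm, HE. clear Heq.
assert (Hen : forall u, physical u ->
  energy_of_theta e (rho u * gam u) (rho u * hh e u * gam u ^ 2 * vel u)
    (theta u) = rho u * hh e u * gam u ^ 2 - pre u).
{ intros u Hu. unfold energy_of_theta. fold (hh e u).
  rewrite (energy_q e u He Hu). pose proof (gam_pos u Hu).
  assert (0 < hh e u).
  { apply enthalpy_pos; [exact He|]. apply Rdiv_lt_0_compat; apply Hu. }
  assert (0 < rho u) by apply Hu.
  unfold theta. field. repeat split; lra. }
assert (Ht : theta w = theta w').
{ pose proof (Hen w Hw) as E1. pose proof (Hen w' Hw') as E2.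
  rewrite <- HD, <- Hm, <- HE in E2.
  assert (0 < rho w * gam w)
    by (apply Rmult_lt_0_compat; [apply Hw|now apply gam_pos]).
  assert (0 < theta w) by (apply Rdiv_lt_0_compat; apply Hw).
  assert (0 < theta w') by (apply Rdiv_lt_0_compat; apply Hw').
  destruct (Rtotal_order (theta w) (theta w')) as [Hlt|[Hlt|Hlt]]; auto;
    apply (energy_of_theta_lt e (rho w * gam w)
             (rho w * hh e w * gam w ^ 2 * vel w)) in Hlt; auto; lra. }
assert (Hh : hh e w = hh e w') by (unfold hh; now rewrite Ht).
pose proof (energy_q e w He Hw) as Q1. pose proof (energy_q e w' He Hw') as Q2.
rewrite <- HD, <- Hm, <- Hh, Q1, Hh in Q2.
assert (0 < hh e w').
{ apply enthalpy_pos; [exact He|]. apply Rdiv_lt_0_compat; apply Hw'. }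
rewrite Hh in HE, Hm.
assert (Hp : pre w = pre w') by lra.
assert (Hr : rho w = rho w').
{ unfold theta in Ht. rewrite Hp in Ht.
  assert (0 < pre w') by apply Hw'.
  assert (0 < rho w) by apply Hw. assert (0 < rho w') by apply Hw'.
  apply (f_equal (fun x => x * rho w * rho w' / pre w')) in Ht.
  field_simplify in Ht; try lra. }
assert (Hv : vel w = vel w').
{ rewrite <- Q2 in Hm. apply Rmult_eq_reg_l in Hm; [exact Hm|].
  assert (0 < rho w) by apply Hw.
  assert (0 < gam w) by now apply gam_pos.
  apply Rgt_not_eq. apply Rmult_lt_0_compat; [|now apply pow_lt].
  now apply Rmult_lt_0_compat. }
destruct w, w'; simpl in *; congruence.
Qed.

Lemma prim_of_cons_of (e : R -> R) (w : prim) :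
  synge_eos e -> physical w -> prim_of e (cons_of e w) = w.
Proof.
intros He Hw. unfold prim_of.
set (P := fun w' => physical w' /\ cons_of e w' = cons_of e w).
assert (HP : P (epsilon (inhabits (Prim 0 0 0)) P))
  by (apply epsilon_spec; exists w; split; auto).
destruct HP as [H1 H2]. now apply (cons_of_inj e).
Qed.

(* Main.v *)
Require Import Defs.
From Stdlib Require Import Reals Lra ClassicalEpsilon.
From Coquelicot Require Import Coquelicot.
Open Scope R_scope.

(** Write [b = 1 / theta] for the variable [z2].  The entropy variables are
    [W1 = ln z1 + g b], [W2 = b * z3] and [W3 = - b * gamma], where
    [g b = b * (1 + e (1 / b)) + 1 - sigma (1 / b)].  The choice of [sigma]
    makes the [e'] terms of [g'] cancel, so that [g' b = 1 + e (1 / b)].  By the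
    fundamental theorem of calculus on the segment from [z2 UL] to [z2 UR], the
    jump of [g] is the jump of [z2] times the mean of [g'] on that segment
    ([W1_thermal_jump]).  This is the integral formula for [calE], and, whether
    or not [z2] jumps, it gives [[W1] = [ln z1] + [z2] * calE]
    ([jump_W1]).

    Entropy conservation is then algebra ([entropy_balance]).  The logarithmic
    mean turns [[ln z1]] into [[z1]], the product rule
    [[a b] = {a}[b] + [a]{b}] splits [[W2]] and [[W3]], and the part of the
    balance that does not contain [[z2]] closes because
    [gamma ^ 2 - z3 ^ 2 = 1] at both states gives [{gamma}[gamma] = {z3}[z3]].
    The coefficient of [[z2]] vanishes by the definition of [rho_h_hat], whose
    denominator is positive since [gamma > |z3|] passes to means. *)

(** * States *)

Lemma prim_of_state (e : R -> R) (U : vec3) :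
  state e U -> physical (prim_of e U) /\ cons_of e (prim_of e U) = U.
Proof. exact (epsilon_spec _ _). Qed.

Lemma z1_pos (e : R -> R) (U : vec3) : state e U -> 0 < z1 e U.
Proof. intros HU. apply (prim_of_state e U HU). Qed.

Lemma z2_pos (e : R -> R) (U : vec3) : state e U -> 0 < z2 e U.
Proof.
intros HU. destruct (prim_of_state e U HU) as [(Hr & Hp & _) _].
now apply Rdiv_lt_0_compat.
Qed.

Lemma gamU_pos (e : R -> R) (U : vec3) : state e U -> 0 < gamU e U.
Proof. intros HU. apply gam_pos, (prim_of_state e U HU). Qed.

Lemma gamU_z3_sqr (e : R -> R) (U : vec3) :
  state e U -> gamU e U ^ 2 - z3 e U ^ 2 = 1.
Proof.
intros HU. unfold gamU, z3.
rewrite <- (gam_sqr (prim_of e U)) by apply (prim_of_state e U HU). ring.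
Qed.

Lemma inv_theta (e : R -> R) (U : vec3) :
  state e U -> / theta (prim_of e U) = z2 e U.
Proof.
intros HU. destruct (prim_of_state e U HU) as [(Hr & Hp & _) _].
unfold z2, theta. field. lra.
Qed.

(** * The integral formula *)

(** The part of [W1] that depends on the temperature only, written in the
    variable [b = 1 / theta] in which its derivative is simplest. *)
Definition W1_thermal (e sigma : R -> R) (b : R) : R :=
  b * (1 + e (1 / b)) + 1 - sigma (1 / b).

Lemma W1_split (e sigma : R -> R) (U : vec3) :
  state e U -> W1 e sigma U = ln (z1 e U) + W1_thermal e sigma (z2 e U).
Proof.
intros HU. pose proof (z2_pos e U HU) as Hb.
unfold W1, hh, enthalpy, entropyS, W1_thermal.
replace (theta (prim_of e U)) with (1 / z2 e U)
  by (rewrite <- (inv_theta e U HU); rewrite Rdiv_1_l; apply Rinv_inv).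
unfold z1. field. lra.
Qed.

(** Differentiating [b * e (1 / b)] produces [- e' (1 / b) / b], and
    [sigma' th = e' th / th] is exactly what compensates it. *)
Lemma is_derive_W1_thermal (e sigma : R -> R) (b : R) :
  (forall th, 0 < th -> ex_derive e th) -> entropy_antiderivative e sigma ->
  0 < b -> is_derive (W1_thermal e sigma) b (1 + e (1 / b)).
Proof.
intros He Hs Hb.
assert (Hth : 0 < 1 / b) by (apply Rdiv_lt_0_compat; lra).
pose proof (He _ Hth) as He'. pose proof (Hs _ Hth) as Hs'.
unfold W1_thermal. auto_derive.
- repeat split; auto; try lra. eexists; exact Hs'.
- change (Derive (fun x => e x)) with (Derive e).
  change (Derive (fun x => sigma x)) with (Derive sigma).
  change (1 * / b) with (1 / b).
  rewrite (is_derive_unique _ _ _ Hs'). field. lra.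
Qed.

Lemma segment_pos (a b s : R) :
  0 < a -> 0 < b -> 0 <= s <= 1 -> 0 < a + s * (b - a).
Proof.
intros Ha Hb Hs. replace (a + s * (b - a)) with ((1 - s) * a + s * b) by ring.
destruct (Req_dec s 0) as [->|Hs0]; [lra|].
apply Rplus_le_lt_0_compat; [apply Rmult_le_pos|apply Rmult_lt_0_compat]; lra.
Qed.

Lemma ex_RInt_e_segment (e : R -> R) (a b : R) :
  (forall th, 0 < th -> ex_derive e th) -> 0 < a -> 0 < b ->
  ex_RInt (fun s => e (1 / (a + s * (b - a)))) 0 1.
Proof.
intros He Ha Hb. apply (@ex_RInt_continuous R_CompleteNormedModule).
intros s Hs. rewrite Rmin_left, Rmax_right in Hs by lra.
pose proof (segment_pos a b s Ha Hb Hs) as Hp.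
apply (@ex_derive_continuous R_AbsRing R_NormedModule). auto_derive.
repeat split; [apply He, Rdiv_lt_0_compat|]; lra.
Qed.

Lemma W1_thermal_jump (e sigma : R -> R) (a b : R) :
  (forall th, 0 < th -> ex_derive e th) -> entropy_antiderivative e sigma ->
  0 < a -> 0 < b ->
  W1_thermal e sigma b - W1_thermal e sigma a
  = (b - a) * (1 + RInt (fun s => e (1 / (a + s * (b - a)))) 0 1).
Proof.
intros He Hs Ha Hb.
pose proof (ex_RInt_e_segment e a b He Ha Hb) as Hex.
set (f := fun s => e (1 / (a + s * (b - a)))) in *.
assert (Hftc : is_RInt (fun s => (b - a) * (1 + f s)) 0 1
  (W1_thermal e sigma (a + 1 * (b - a)) - W1_thermal e sigma (a + 0 * (b - a)))).
{ apply (is_RInt_derive (fun s => W1_thermal e sigma (a + s * (b - a)))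
           (fun s => (b - a) * (1 + f s)));
  intros s Hs01; rewrite Rmin_left, Rmax_right in Hs01 by lra;
  pose proof (segment_pos a b s Ha Hb Hs01) as Hp.
  - apply (is_derive_comp (W1_thermal e sigma) (fun s => a + s * (b - a))).
    + now apply is_derive_W1_thermal.
    + auto_derive; [trivial|ring].
  - apply (@ex_derive_continuous R_AbsRing R_NormedModule). unfold f.
    auto_derive. repeat split; [apply He, Rdiv_lt_0_compat|]; lra. }
assert (Hlin : is_RInt (fun s => (b - a) * (1 + f s)) 0 1
  ((b - a) * ((1 - 0) * 1 + RInt f 0 1))).
{ apply (is_RInt_scal (fun s => 1 + f s)).
  apply (is_RInt_plus (fun _ => 1) f).
  - apply (@is_RInt_const R_NormedModule).
  - now apply (@RInt_correct R_CompleteNormedModule). }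
apply (@is_RInt_unique R_CompleteNormedModule) in Hftc, Hlin.
rewrite Hftc in Hlin.
replace (a + 1 * (b - a)) with b in Hlin by ring.
replace (a + 0 * (b - a)) with a in Hlin by ring.
rewrite Hlin. ring.
Qed.

Lemma jump_W1_thermal (e sigma : R -> R) (UL UR : vec3) :
  state e UL -> state e UR ->
  jump (W1 e sigma) UL UR - jump (fun U => ln (z1 e U)) UL UR
  = W1_thermal e sigma (z2 e UR) - W1_thermal e sigma (z2 e UL).
Proof. intros HL HR. unfold jump. rewrite !W1_split by assumption. ring. Qed.

Lemma calE_integral (e sigma : R -> R) (UL UR : vec3) :
  (forall th, 0 < th -> ex_derive e th) -> entropy_antiderivative e sigma ->
  state e UL -> state e UR ->
  calE e sigma UL UR = 1 + RInt (calE_integrand e UL UR) 0 1.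
Proof.
intros He Hs HL HR. unfold calE.
destruct (Req_EM_T (jump (z2 e) UL UR) 0) as [|Hne]; [reflexivity|].
rewrite jump_W1_thermal, W1_thermal_jump by (auto using z2_pos).
unfold calE_integrand, jump in *. now field.
Qed.

Lemma jump_W1 (e sigma : R -> R) (UL UR : vec3) :
  (forall th, 0 < th -> ex_derive e th) -> entropy_antiderivative e sigma ->
  state e UL -> state e UR ->
  W1 e sigma UR - W1 e sigma UL
  = ln (z1 e UR) - ln (z1 e UL) + (z2 e UR - z2 e UL) * calE e sigma UL UR.
Proof.
intros He Hs HL HR. rewrite calE_integral by assumption.
unfold calE_integrand. rewrite <- (W1_thermal_jump e sigma) by (auto using z2_pos).
rewrite <- jump_W1_thermal by assumption. unfold jump. ring.
Qed.

(** * Entropy conservation *)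

Lemma logmean_jump (a : vec3 -> R) (UL UR : vec3) :
  0 < a UL -> 0 < a UR ->
  (ln (a UR) - ln (a UL)) * logmean a UL UR = a UR - a UL.
Proof.
intros HL HR. unfold logmean, jump.
destruct (Req_EM_T (a UL) (a UR)) as [->|Hne]; [ring|].
assert (ln (a UR) - ln (a UL) <> 0).
{ intros H0. apply Hne, ln_inv; lra. }
now field.
Qed.

(** On the hyperbola [g ^ 2 - z ^ 2 = 1, g > 0] one has [|z| < g], a convex
    condition, so it survives averaging even though the equation does not. *)
Lemma hyperbola_mean_pos (gL gR zL zR : R) :
  0 < gL -> 0 < gR -> gL ^ 2 - zL ^ 2 = 1 -> gR ^ 2 - zR ^ 2 = 1 ->
  0 < ((gL + gR) / 2) ^ 2 - ((zL + zR) / 2) ^ 2.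
Proof.
intros HgL HgR HL HR.
assert (Hcone : forall g z, 0 < g -> g ^ 2 - z ^ 2 = 1 -> - g < z < g)
  by (intros; split; nra).
pose proof (Hcone _ _ HgL HL). pose proof (Hcone _ _ HgR HR).
replace (((gL + gR) / 2) ^ 2 - ((zL + zR) / 2) ^ 2)
  with ((gL - zL + (gR - zR)) * (gL + zL + (gR + zR)) / 4) by field.
apply Rdiv_lt_0_compat; [apply Rmult_lt_0_compat|]; lra.
Qed.

(** The entropy balance in the variables [r = z1], [b = z2], [z = z3] and
    [g = gamma]: [l] plays the logarithmic mean, [dln] the jump of the
    logarithm, [E] is [calE], and [H] is [rho_h_hat], which enters only
    through the equation that defines it. *)
Lemma entropy_balance (rL rR bL bR zL zR gL gR l dln E H : R) :
  let bm := (bL + bR) / 2 in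
  let zm := (zL + zR) / 2 in
  let gm := (gL + gR) / 2 in
  let p := (rL + rR) / 2 / bm in
  bm <> 0 -> dln * l = rR - rL ->
  gL ^ 2 - zL ^ 2 = 1 -> gR ^ 2 - zR ^ 2 = 1 ->
  H * (gm ^ 2 - zm ^ 2) = p + l * E ->
  (dln + (bR - bL) * E) * (l * zm)
  + (bR * zR - bL * zL) * (H * zm ^ 2 + p)
  + (- (bR * gR) + bL * gL) * (H * gm * zm)
  = rR * zR - rL * zL.
Proof.
intros bm zm gm p Hb Hl HgL HgR HH.
assert (Hp : bm * p = (rL + rR) / 2) by (unfold p; field; exact Hb).
assert (Hg : gm * (gR - gL) = zm * (zR - zL)) by (unfold gm, zm; nra).
replace (bR * zR - bL * zL) with (bm * (zR - zL) + (bR - bL) * zm)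
  by (unfold bm, zm; field).
replace (- (bR * gR) + bL * gL) with (- (bm * (gR - gL)) - (bR - bL) * gm)
  by (unfold bm, gm; field).
(* The three groups vanish or reduce by Hl, Hg and HH; the remaining
   [bm * p * [z]] is the mean of [r] times the jump of [z]. *)
transitivity (dln * l * zm + bm * p * (zR - zL)
  + bm * H * zm * (zm * (zR - zL) - gm * (gR - gL))
  + (bR - bL) * zm * (p + l * E - H * (gm ^ 2 - zm ^ 2))); [ring|].
rewrite Hl, Hp, Hg, HH. unfold zm. field.
Qed.

Lemma flux1_EC_consistent (e sigma : R -> R) (U : vec3) :
  state e U -> flux1_EC e sigma U U = flux1 e U.
Proof.
intros HU. pose proof (prim_of_state e U HU) as [(Hr & Hp & _) HU'].
pose proof (gamU_z3_sqr e U HU) as Hg.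
assert (HE : calE e sigma U U = 1 + e (theta (prim_of e U))).
{ unfold calE, jump.
  destruct (Req_EM_T (z2 e U - z2 e U) 0) as [_|Hne]; [|now destruct Hne; ring].
  f_equal. rewrite (RInt_ext _ (fun _ => e (theta (prim_of e U)))).
  - rewrite RInt_const. unfold scal; simpl; unfold mult; simpl. ring.
  - intros s _. unfold calE_integrand. f_equal.
    unfold z2, theta. field. lra. }
assert (Hm : forall a, mean a U U = a U) by (intros a; unfold mean; field).
assert (Hl : logmean (z1 e) U U = z1 e U)
  by (unfold logmean; now destruct (Req_EM_T (z1 e U) (z1 e U))).
assert (Hpz : z1 e U / z2 e U = Defs.pre (prim_of e U))
  by (unfold z1, z2; field; lra).
assert (HH : rho_h_hat e sigma U U
             = rho (prim_of e U) * hh e (prim_of e U)).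
{ unfold rho_h_hat. rewrite !Hm, Hl, HE, Hg, Hpz.
  unfold z1, hh, enthalpy, theta. field. lra. }
unfold flux1_EC, flux1. rewrite !Hm, Hl, HH, Hpz.
(* Abstracting [prim_of e U] first keeps it fixed while [U] itself is replaced
   by [cons_of e w]. *)
unfold z1, z3, gamU. revert HU'. generalize (prim_of e U). intros w <-.
unfold cons_of. f_equal; [f_equal|]; ring.
Qed.

Lemma flux1_EC_balance (e sigma : R -> R) (UL UR : vec3) :
  (forall th, 0 < th -> ex_derive e th) -> entropy_antiderivative e sigma ->
  state e UL -> state e UR ->
  dot3 (sub3 (entropy_vars e sigma UR) (entropy_vars e sigma UL))
    (flux1_EC e sigma UL UR) = psi1 e UR - psi1 e UL.
Proof.
intros He Hs HL HR.
pose proof (z1_pos e UL HL). pose proof (z1_pos e UR HR).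
pose proof (z2_pos e UL HL). pose proof (z2_pos e UR HR).
pose proof (gamU_z3_sqr e UL HL) as HgL. pose proof (gamU_z3_sqr e UR HR) as HgR.
pose proof (hyperbola_mean_pos _ _ _ _ (gamU_pos e UL HL) (gamU_pos e UR HR)
              HgL HgR) as Hden.
assert (HW2 : forall U, state e U -> W2 e U = z2 e U * z3 e U).
{ intros U HU. unfold W2. now rewrite inv_theta. }
assert (HW3 : forall U, state e U -> W3 e U = - (z2 e U * gamU e U)).
{ intros U HU. unfold W3. rewrite inv_theta by exact HU. unfold gamU. ring. }
assert (Hpsi : forall U, psi1 e U = z1 e U * z3 e U).
{ intros U. unfold psi1, z1, z3. ring. }
unfold entropy_vars, flux1_EC, sub3, dot3.
rewrite !HW2, !HW3, !Hpsi, jump_W1 by assumption.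
rewrite <- (entropy_balance (z1 e UL) (z1 e UR) (z2 e UL) (z2 e UR)
  (z3 e UL) (z3 e UR) (gamU e UL) (gamU e UR) (logmean (z1 e) UL UR)
  (ln (z1 e UR) - ln (z1 e UL)) (calE e sigma UL UR)
  (rho_h_hat e sigma UL UR)).
- unfold mean. ring.
- lra.
- now apply logmean_jump.
- exact HgL.
- exact HgR.
- unfold rho_h_hat, mean. field. split; lra.
Qed.

Theorem theorem4 (e sigma : R -> R) (he : synge_eos e)
  (hsigma : entropy_antiderivative e sigma) :
  entropy_conservative e sigma (flux1_EC e sigma) /\
  (forall UL UR : vec3, state e UL -> state e UR ->
     ex_RInt (fun s => e (1 / (z2 e UL + s * (z2 e UR - z2 e UL)))) 0 1 /\
     calE e sigma UL UR =
       1 + RInt (fun s => e (1 / (z2 e UL + s * (z2 e UR - z2 e UL)))) 0 1).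
Proof.
destruct he as [He _]. repeat split.
- exact (flux1_EC_consistent e sigma).
- intros UL UR. now apply flux1_EC_balance.
- apply ex_RInt_e_segment; auto using z2_pos.
- now apply calE_integral.
Qed.
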